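(* Consider $N$ agents whose states stack into $x\in\mathbb{R}^n$, each state coordinate belonging to exactly one agent. Let $A\in\mathbb{R}^{n\times n}$, $W\in\mathbb{R}^{n\times n}$ symmetric positive definite, $C=\mathrm{diag}(C_{11},\dots,C_{nn})$ diagonal positive definite (block-diagonal over agents, agent $i$'s block being $C_i$). For each agent $i$ let $\Delta_{\ell_2}y_i>0$ be the $\ell_2$-sensitivity of its output map, take $\delta_i\in[10^{-5},10^{-1}]$, $\epsilon_i>0$, and set $\sigma_i=\frac{\Delta_{\ell_2}y_i}{2\epsilon_i}\big(K_{\delta_i}+\sqrt{K_{\delta_i}^2+2\epsilon_i}\big)$; let $V$ be the diagonal matrix whose $j$-th diagonal entry is $\sigma_i^2$ for the agent $i$ owning coordinate $j$. Let $\Sigma$ be the unique positive semidefinite solution of $\Sigma=A\Sigma A^T-A\Sigma C^T(C\Sigma C^T+V)^{-1}C\Sigma A^T+W$ (the MSE matrix of the a priori predictions). Let $B_l,B_u$ be real numbers and define, for each $i$, $$\eta_1:=\left(\frac{(B_l-\mathrm{tr}W)\lambda_n(W)C_u^2}{(\Delta_{\ell_2}y_i)^2\big(\mathrm{tr}(A^TA)\lambda_n(W)-B_l+\mathrm{tr}W\big)}\right)^{1/2},\quad \eta_2:=\left(\frac{(B_u-\mathrm{tr}W)C_l^2}{(\Delta_{\ell_2}y_i)^2\,\mathrm{tr}(A^TA)}\right)^{1/2},$$ assumed to be positive real numbers. If every agent $i$ chooses $\epsilon_i$ with $$\frac18\left(\frac{1+\sqrt{36\eta_2+1}}{\eta_2}\right)^2\le\epsilon_i\le\frac1{\eta_1},$$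 then $B_l\le\mathrm{tr}\,\Sigma\le B_u$.
   Context: $\mathcal{Q}(y)=\frac{1}{\sqrt{2\pi}}\int_y^\infty e^{-z^2/2}dz$ and $K_\delta=\mathcal{Q}^{-1}(\delta)$. $\lambda_n(\cdot)$ is the smallest eigenvalue. With $\sigma_j$ denoting the noise level of coordinate $j$ (i.e. $V_{jj}=\sigma_j^2$), $l=\arg\min_j C_{jj}^2/\sigma_j^2$, $u=\arg\max_j C_{jj}^2/\sigma_j^2$, $C_l=C_{ll}$, $C_u=C_{uu}$. The $\ell_2$-sensitivity of agent $i$'s output $y_i(k)=C_ix_i(k)$ is $\sup\|C_ix_i-C_ix_i'\|_{\ell_2}$ over state trajectories with $\|x_i-x_i'\|_{\ell_2}\le b_i$ for a given adjacency parameter $b_i>0$. *)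

(* Defs.v *)
From HB Require Import structures.
From mathcomp Require Import all_boot all_order all_algebra.
From mathcomp Require Import all_classical all_reals all_analysis.
Set Implicit Arguments. Unset Strict Implicit. Unset Printing Implicit Defensive.
Import Order.TTheory GRing.Theory Num.Theory.
Local Open Scope ring_scope.
Local Open Scope classical_set_scope.

Section Defs.
Variable R : realType.

Definition Qfun (y : R) : R :=
  (Num.sqrt (2 * pi))^-1 *
  fine (\int[@lebesgue_measure R]_(z in `[y, +oo[) (expR (- (z ^+ 2) / 2))%:E)%E.

Definition psd {n : nat} (M : 'M[R]_n) : Prop :=
  M^T = M /\ forall v : 'cV[R]_n, 0 <= (v^T *m M *m v) 0 0.

Definition pd {n : nat} (M : 'M[R]_n) : Prop :=
  M^T = M /\ forall v : 'cV[R]_n, v != 0 -> 0 < (v^T *m M *m v) 0 0.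

Definition is_min_eigenvalue {n : nat} (M : 'M[R]_n) (lam : R) : Prop :=
  eigenvalue M lam /\ forall a, eigenvalue M a -> lam <= a.

Definition agent_l2sq {n N : nat} (owner : 'I_n -> 'I_N) (i : 'I_N)
  (x : nat -> 'cV[R]_n) : \bar R :=
  (\sum_(0 <= k <oo) (\sum_(j < n | owner j == i) (x k j 0) ^+ 2)%:E)%E.

(* squared l2-sensitivity of agent i's output y_i(k) = C_i x_i(k) :
   sup ||C_i x_i - C_i x_i'||^2 over trajectories with ||x_i - x_i'|| <= b *)
Definition sens_sq {n N : nat} (owner : 'I_n -> 'I_N) (C : 'M[R]_n)
  (i : 'I_N) (b : R) : \bar R :=
  ereal_sup [set agent_l2sq owner i (fun k => (C *m xx.1 k - C *m xx.2 k)%R) |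
     xx in [set xx : (nat -> 'cV[R]_n) * (nat -> 'cV[R]_n) |
       (agent_l2sq owner i (fun k => (xx.1 k - xx.2 k)%R) <= (b ^+ 2)%:E)%E]].

End Defs.

(* Main.v *)
(** With P = Sigma - Sigma C^T (C Sigma C^T + V)^-1 C Sigma, the Riccati equation
    reads Sigma = A P A^T + W.  Since C P C^T = V - V (C Sigma C^T + V)^-1 V,
    dropping the last term gives P <= C^-1 V C^-T <= (sigma_l^2 / C_l^2) I, while
    Sigma >= W >= lambda_n(W) I gives
    P >= lambda_n(W) / (1 + lambda_n(W) C_u^2 / sigma_u^2) I.
    Taking traces, the bounds on tr Sigma follow once
    eta_1 <= sigma_i / Delta_i <= eta_2.  The two bounds on eps_i yield this as soon as
    1 <= K_i <= 9/2: the lower bound on eps_i says that sqrt (2 eps_i) exceeds the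
    positive root of eta_2 s^2 - s - 9.  The enclosure of K_i comes from the Mills-ratio
    bounds Q(1) > 1/10 and Q(9/2) < 10^-5. *)
Require Import Defs.
From HB Require Import structures.
From mathcomp Require Import all_boot all_order all_algebra.
From mathcomp Require Import all_classical all_reals all_analysis.
From mathcomp Require Import measurable_realfun ring lra.
Import Order.TTheory GRing.Theory Num.Theory.
Import numFieldNormedType.Exports.
Local Open Scope ring_scope.

(** * Gaussian tails *)

Section GaussianTail.
Local Open Scope classical_set_scope.
Context {R : realType}.
Local Notation mu := (@lebesgue_measure R).

Definition gauss (z : R) : R := expR (- (z ^+ 2) / 2).

Lemma gauss_gt0 z : 0 < gauss z. Proof. exact: expR_gt0. Qed.

Lemma is_derive_gauss (x : R) : is_derive x 1 gauss (- x * gauss x).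
Proof.
have H : is_derive x 1 (fun z : R => - (z ^+ 2) / 2) (- x).
  by apply: is_derive_eq; rewrite !scaler0 /= add0r /GRing.scale /=; field.
by apply: is_derive_eq; rewrite mulrC.
Qed.

Lemma cvg_gauss : gauss x @[x --> +oo%R] --> (0 : R).
Proof.
apply: (@squeeze_cvgr _ _ _ _ (cst 0) (fun x => expR (- x))).
- near=> x; rewrite ltW ?gauss_gt0//= ler_expR.
  have : 2 <= x by near: x; apply: nbhs_pinfty_ge; exact: num_real.
  by move=> ?; nra.
- exact: cvg_cst.
- exact: cvgr_expR.
Unshelve. all: by end_near. Qed.

Lemma continuous_gauss : continuous gauss.
Proof.
move=> x; apply: differentiable_continuous; apply/derivable1_diffP.
by have [] := is_derive_gauss x.
Qed.

(* The derivative of [- gauss z / (z + c)]: for [c = 0] it dominates [gauss] on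
   positive reals, for [c = 1] it is dominated by [gauss]. *)
Definition mills (c z : R) : R := gauss z * (z / (z + c) + ((z + c) ^+ 2)^-1).

Lemma within_continuous_mills (a c : R) : 0 < a + c ->
  {within `[a, +oo[, continuous (mills c)}.
Proof.
move=> ac0.
have pos x : a <= x -> 0 < x + c by move=> ax; lra.
have cI x : a <= x -> {for x, continuous (fun z : R => (z + c)^-1)}.
  move=> /pos xc0; apply: (@cvgV _ _ _ _ (fun z => z + c)).
    by rewrite gt_eqF.
  by apply: cvgD; [exact: cvg_id|exact: cvg_cst].
apply: continuous_in_subspaceT => x; rewrite inE/= in_itv/= andbT => ax.
apply: cvgM; first exact: continuous_gauss.
apply: cvgD.
  by apply: cvgM; [exact: cvg_id|exact: cI].
under eq_fun do rewrite -exprVn.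
rewrite -exprVn.
apply: (cvg_comp (fun z => (z + c)^-1) (fun z => z ^+ 2)); first exact: cI.
exact: exprn_continuous.
Qed.

Lemma integral_gauss_mills (a c : R) : 0 <= a -> 0 <= c -> 0 < a + c ->
  (\int[mu]_(z in `[a, +oo[) (mills c z)%:E = (gauss a / (a + c))%:E)%E.
Proof.
move=> a0 c0 ac0.
pose F x := - (gauss x * (x + c)^-1).
have pos x : a <= x -> 0 < x + c by move=> ax; lra.
have dF x : a <= x -> is_derive x 1 F (mills c x).
  move=> /pos xc0; have xcN0 : x + c != 0 by rewrite gt_eqF.
  have dg := is_derive_gauss x.
  have dV : is_derive x 1 (fun z : R => (z + c)^-1) (- (x + c) ^- 2).
    have := @is_deriveV R (fun z => z + c) x 1 1 xcN0 _.
    rewrite /GRing.scale /= mulr1; apply.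
    by apply: is_derive_eq; rewrite addr0.
  by apply: is_derive_eq; rewrite /mills /GRing.scale /=; field.
rewrite (@ge0_continuous_FTC2y _ _ F a 0).
- by rewrite /F -EFinB sub0r opprK.
- move=> x ax; have := pos _ ax => xc0.
  have x0 : 0 <= x by exact: le_trans ax.
  rewrite mulr_ge0 ?(ltW (gauss_gt0 _))// addr_ge0//.
    by rewrite divr_ge0// ltW.
  by rewrite invr_ge0 sqr_ge0.
- exact: within_continuous_mills.
(* The antiderivative vanishes at infinity: once [x >= 1], also [x + c >= 1], so the quotient lies
   between [0] and [gauss x]. *)
- rewrite -oppr0; apply: cvgN.
  apply: (@squeeze_cvgr _ _ _ _ (cst 0) gauss).
  + near=> x.
    have x1 : 1 <= x by near: x; apply: nbhs_pinfty_ge; exact: num_real.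
    have xc1 : 1 <= x + c by lra.
    have xc0 : 0 < x + c by lra.
    rewrite mulr_ge0 ?(ltW (gauss_gt0 _)) ?invr_ge0 ?(ltW xc0)//=.
    by rewrite ler_piMr ?(ltW (gauss_gt0 _))// invf_le1.
  + exact: cvg_cst.
  + exact: cvg_gauss.
- by move=> x /ltW /dF[].
- apply: cvg_at_right_filter.
  apply: differentiable_continuous; apply/derivable1_diffP.
  by have [] := dF _ (lexx a).
- move=> x; rewrite in_itv/= andbT => /ltW /dF dFx.
  by rewrite derive1E derive_val.
Unshelve. all: by end_near. Qed.

Lemma measurable_gauss : measurable_fun setT gauss.
Proof. by apply: continuous_measurable_fun; exact: continuous_gauss. Qed.

Local Notation tail y := (\int[mu]_(z in `[y, +oo[) (gauss z)%:E)%E.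

Lemma measurable_mills (a c : R) : 0 < a + c ->
  measurable_fun `[a, +oo[ (fun z => (mills c z)%:E).
Proof.
move=> ac0; apply/measurable_EFinP.
by apply: subspace_continuous_measurable_fun => //; exact: within_continuous_mills.
Qed.

Lemma gauss_tail_le (a : R) : 0 < a -> (tail a <= (gauss a / a)%:E)%E.
Proof.
move=> a0; rewrite -[X in gauss a / X]addr0 -integral_gauss_mills ?addr0 ?(ltW a0)//.
apply: ge0_le_integral => //=.
- by move=> x _; rewrite lee_fin ltW ?gauss_gt0.
- by apply: measurable_funTS; apply/measurable_EFinP; exact: measurable_gauss.
- by apply: measurable_mills; lra.
move=> x; rewrite in_itv/= andbT => ax; have x0 : 0 < x by exact: lt_le_trans ax.
rewrite lee_fin /mills addr0 divff ?gt_eqF// ler_peMr ?(ltW (gauss_gt0 _))//.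
by rewrite lerDl invr_ge0 sqr_ge0.
Qed.

Lemma gauss_tail_ge (a : R) : 0 <= a -> ((gauss a / (a + 1))%:E <= tail a)%E.
Proof.
move=> a0; rewrite -integral_gauss_mills//; last by lra.
apply: ge0_le_integral => //=.
- move=> x; rewrite in_itv/= andbT => ax; have x0 : 0 <= x by exact: le_trans ax.
  rewrite lee_fin /mills mulr_ge0 ?(ltW (gauss_gt0 _))// addr_ge0//.
    by rewrite divr_ge0// addr_ge0.
  by rewrite invr_ge0 sqr_ge0.
- by apply: measurable_mills; lra.
- by apply: measurable_funTS; apply/measurable_EFinP; exact: measurable_gauss.
move=> x; rewrite in_itv/= andbT => ax; have x0 : 0 <= x by exact: le_trans ax.
rewrite lee_fin /mills ler_piMr ?(ltW (gauss_gt0 _))//.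
have x1 : 0 < x + 1 by lra.
rewrite (_ : _ + _ = (x * (x + 1) + 1) / (x + 1) ^+ 2); last by field; lra.
by rewrite ler_pdivrMr ?exprn_gt0//; nra.
Qed.

Lemma gauss_tail_antitone (a b : R) : a <= b -> (tail b <= tail a)%E.
Proof.
move=> ab; apply: ge0_subset_integral => //=.
- by apply: measurable_funTS; apply/measurable_EFinP; exact: measurable_gauss.
- by move=> x _; rewrite lee_fin ltW ?gauss_gt0.
- by move=> x; rewrite /= !in_itv/= !andbT; exact: le_trans.
Qed.

(** The claim amounts to [expR (81 / 8) > 10^5 / 9], hence the constant 11112. It follows from
    [expR (1 / 8) >= 9 / 8] by taking two ninth powers, with 2.88 as a rounded intermediate value.
    The factor 2 on the right is absorbed later by [sqrt (2 * pi) >= 2]. *)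
Lemma gauss_9half_lt : gauss (9 / 2) / (9 / 2) < 2 * 10 ^- 5.
Proof.
have e9 : 11112 < expR ((9 / 2) ^+ 2 / 2 : R).
  rewrite (_ : (9 / 2) ^+ 2 / 2 = (9 * 9)%:R * (1 / 8)); last by field.
  rewrite expRM_natl exprM.
  have h : 9 / 8 <= expR (1 / 8 : R).
    by apply: le_trans (expR_ge1Dx _); lra.
  have h2 : 288 / 100 <= expR (1 / 8 : R) ^+ 9.
    apply: (@le_trans _ _ ((9 / 8) ^+ 9)); first by lra.
    by rewrite lerXn2r// nnegrE ?expR_ge0.
  apply: (@lt_le_trans _ _ ((288 / 100) ^+ 9)); first by lra.
  by rewrite lerXn2r// nnegrE ?exprn_ge0 ?expR_ge0//.
rewrite /gauss mulNr expRN -invfM.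
set e := expR _ in e9 *.
rewrite invf_plt ?posrE; [|by lra|by lra].
by rewrite invfM invrK; lra.
Qed.

(** The threshold is one tenth of the upper bound 2.83 on [sqrt (2 * pi)]. The tangent bound at 0 is
    applied to [- 1 / 8] and raised to the fourth power, since at [- 1 / 2] itself it is too
    weak. *)
Lemma gauss_1_gt : 283 / 1000 < gauss 1 / (1 + 1).
Proof.
have h : 7 / 8 <= expR (- 1 / 8 : R).
  by apply: le_trans (expR_ge1Dx _); lra.
have : (7 / 8) ^+ 4 <= gauss 1.
  rewrite /gauss (_ : - 1 ^+ 2 / 2 = 4%:R * (- 1 / 8)); last by field.
  by rewrite expRM_natl lerXn2r// nnegrE ?expR_ge0.
by rewrite -[1 + 1]/(2%:R : R); lra.
Qed.

(** The crude enclosure of [pi] between 2 and 4 suffices, because [2.83 ^+ 2] exceeds 8. *)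
Lemma sqrt_2pi_bounds : 2 <= Num.sqrt (2 * pi : R) <= 283 / 100.
Proof.
have p2 := pi_ge2 R; have p4 := pihalf_lt2 R.
have s0 : 0 <= Num.sqrt (2 * pi : R) by exact: sqrtr_ge0.
have sE : Num.sqrt (2 * pi : R) ^+ 2 = 2 * pi by rewrite sqr_sqrtr//; lra.
by apply/andP; split; nra.
Qed.

Lemma Qfun_le_inv (y : R) : 10 ^- 5 <= Qfun y -> y <= 9 / 2.
Proof.
move=> dl; rewrite leNgt; apply/negP => yl.
have /andP[s2 _] := sqrt_2pi_bounds.
have a0 : (0 : R) < 9 / 2 by lra.
have h := le_trans (gauss_tail_antitone _ _ (ltW yl)) (gauss_tail_le _ a0).
have h0 : (0 <= tail y)%E.
  by apply: integral_ge0 => x _; rewrite lee_fin ltW ?gauss_gt0.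
have /le_lt_trans/(_ gauss_9half_lt) : fine (tail y) <= gauss (9 / 2) / (9 / 2).
  (* The upper bound on the tail also shows that it is finite, so [fine] loses nothing here. *)
  by rewrite -lee_fin fineK// ge0_fin_numE// (le_lt_trans h)// ltry.
have : fine (tail y) = Num.sqrt (2 * pi) * Qfun y.
  by rewrite /Qfun mulrA divff ?mul1r// gt_eqF//; lra.
move=> ->; nra.
Qed.

(* An infinite tail would be sent to [0] by [fine], which [0 < Qfun y] excludes. *)
Lemma Qfun_ge_inv (y : R) : 0 < Qfun y <= 10 ^- 1 -> 1 <= y.
Proof.
move=> /andP[d0 dl]; rewrite leNgt; apply/negP => yl.
have /andP[s2 s3] := sqrt_2pi_bounds.
have h := le_trans (gauss_tail_ge _ (@ler01 R)) (gauss_tail_antitone _ _ (ltW yl)).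
have tE : fine (tail y) = Num.sqrt (2 * pi) * Qfun y.
  by rewrite /Qfun mulrA divff ?mul1r// gt_eqF//; lra.
have t0 : 0 < fine (tail y) by rewrite tE mulr_gt0//; lra.
have : gauss 1 / (1 + 1) <= fine (tail y).
  by rewrite -lee_fin fineK//; move: t0; case: (tail y) => //=; rewrite ltxx.
by have := gauss_1_gt; rewrite tE; nra.
Qed.

End GaussianTail.

(** * Quadratic forms *)

Section DotProduct.
Context {R : realType} {n : nat}.
Implicit Types (x y v w : 'cV[R]_n) (M : 'M[R]_n).

Definition dot x y : R := (x^T *m y) 0 0.

Lemma dotE x y : dot x y = \sum_j x j 0 * y j 0.
Proof. by rewrite /dot mxE; apply: eq_bigr => j _; rewrite mxE. Qed.

Lemma dotC x y : dot x y = dot y x.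
Proof. by rewrite !dotE; apply: eq_bigr => j _; rewrite mulrC. Qed.

Lemma dotBr x y v : dot x (y - v) = dot x y - dot x v.
Proof. by rewrite /dot mulmxBr !mxE. Qed.

Lemma dotDr x y v : dot x (y + v) = dot x y + dot x v.
Proof. by rewrite /dot mulmxDr !mxE. Qed.

Lemma dotZr a x y : dot x (a *: y) = a * dot x y.
Proof. by rewrite /dot -scalemxAr !mxE. Qed.

Lemma dotBl x y v : dot (x - y) v = dot x v - dot y v.
Proof. by rewrite dotC dotBr !(dotC v). Qed.

Lemma dotZl a x y : dot (a *: x) y = a * dot x y.
Proof. by rewrite dotC dotZr dotC. Qed.

Lemma dot_mulmxl M x y : dot (M *m x) y = dot x (M^T *m y).
Proof. by rewrite /dot trmx_mul mulmxA. Qed.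

Lemma dot_sq x : dot x x = \sum_j x j 0 ^+ 2.
Proof. by rewrite dotE; apply: eq_bigr => j _; rewrite expr2. Qed.

Lemma dot_ge0 x : 0 <= dot x x.
Proof. by rewrite dot_sq sumr_ge0// => j _; rewrite sqr_ge0. Qed.

Lemma dot_gt0 x : x != 0 -> 0 < dot x x.
Proof.
move=> x0; rewrite lt0r dot_ge0 andbT; apply: contra x0.
rewrite dot_sq psumr_eq0 => [/allP x0|j _]; last exact: sqr_ge0.
apply/eqP/colP => j; rewrite mxE; apply/eqP.
by rewrite -sqrf_eq0; apply: x0; rewrite mem_index_enum.
Qed.

Definition qf M v : R := dot v (M *m v).

Lemma qfE M v : (v^T *m M *m v) 0 0 = qf M v.
Proof. by rewrite /qf /dot mulmxA. Qed.

Lemma qfB M M' v : qf (M - M') v = qf M v - qf M' v.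
Proof. by rewrite /qf mulmxBl dotBr. Qed.

Lemma qfD M M' v : qf (M + M') v = qf M v + qf M' v.
Proof. by rewrite /qf mulmxDl dotDr. Qed.

Lemma qf_congr B M v : qf (B *m M *m B^T) v = qf M (B^T *m v).
Proof. by rewrite /qf dot_mulmxl trmxK !mulmxA. Qed.

Lemma qf_diag (d : 'rV[R]_n) v : qf (diag_mx d) v = \sum_j d 0 j * v j 0 ^+ 2.
Proof.
by rewrite /qf dotE; apply: eq_bigr => j _; rewrite mul_diag_mx mxE; ring.
Qed.

Lemma qf_unitmx M : (forall v, v != 0 -> 0 < qf M v) -> M \in unitmx.
Proof.
move=> Mpos; rewrite -row_free_unit; apply: inj_row_free => u uM.
apply: contraTeq isT => u0.
have : 0 < qf M u^T by rewrite Mpos// trmx_eq0.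
by rewrite -qfE trmxK uM mul0mx mxE ltxx.
Qed.

Lemma qf_le_dot M : exists2 k : R, 0 < k & forall v, qf M v <= k * dot v v.
Proof.
pose s : R := \sum_i \sum_j `|M i j|.
have s0 : 0 <= s by apply: sumr_ge0 => i _; apply: sumr_ge0.
(* The extra 1 keeps the constant positive when [M] is zero. *)
exists (s + 1); first by lra.
move=> v; apply: (@le_trans _ _ (s * dot v v)); last first.
  by have := dot_ge0 v; lra.
have vle i : v i 0 ^+ 2 <= dot v v.
  rewrite dot_sq (bigD1 i)//= lerDl sumr_ge0// => j _; exact: sqr_ge0.
rewrite /qf dotE mulr_suml; apply: ler_sum => i _.
rewrite mxE mulr_sumr mulr_suml; apply: ler_sum => j _.
(* The squares of [v i 0 - v j 0] and [v i 0 + v j 0] give [|v_i v_j| <= |v|^2], so each entry of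
   [M] contributes at most its absolute value times [dot v v]. *)
have := vle i; have := vle j; have := sqr_ge0 (v i 0 - v j 0).
have := sqr_ge0 (v i 0 + v j 0).
have := ler_norm (M i j); have := lerNnormlW (lexx `|M i j|).
have := normr_ge0 (M i j).
move: (v i 0) (v j 0) (dot v v) (M i j) `|M i j| => a b d m nm *.
have : a * b <= d by nra.
have : - d <= a * b by nra.
nra.
Qed.

End DotProduct.

(** A variational argument replaces diagonalisation. The index [i0] makes the space nonzero, so that
    some Rayleigh quotient exists to bound the admissible [m] from above. *)
Lemma rayleigh {R : realType} {n : nat} (W : 'M[R]_n) (lam : R) (i0 : 'I_n) :
  pd W -> is_min_eigenvalue W lam ->
  0 < lam /\ forall v : 'cV_n, lam * dot v v <= qf W v.
Proof.
move=> [Wsym Wpos] [/eigenvalueP[u uW u0] lam_min].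
have Wgt0 v : v != 0 -> 0 < qf W v by move=> /Wpos; rewrite qfE.
have Wge0 v : 0 <= qf W v.
  have [->|/Wgt0/ltW//] := eqVneq v 0.
  by rewrite /qf mulmx0 /dot mulmx0 mxE.
split.
  have ut0 : u^T != 0 by rewrite trmx_eq0.
  have := Wgt0 _ ut0; rewrite -qfE trmxK uW -scalemxAl mxE -{1}[u]trmxK.
  by rewrite -/(dot _ _) pmulr_lgt0 ?dot_gt0.
(* The largest [m] with [W - m I] nonnegative is an eigenvalue. *)
pose E : set R := [set m | forall v : 'cV_n, m * dot v v <= qf W v]%classic.
have E0 : E 0 by move=> v; rewrite mul0r.
have Eub (v : 'cV_n) : v != 0 -> ubound E (qf W v / dot v v).
  by move=> v0 m Em; rewrite ler_pdivlMr ?dot_gt0// Em.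
have supE : has_sup E.
  split; first by exists 0.
  pose e : 'cV[R]_n := delta_mx i0 0.
  exists (qf W e / dot e e); apply: Eub.
  apply/eqP => /matrixP/(_ i0 0); rewrite !mxE !eqxx => /eqP.
  by rewrite oner_eq0.
have Esup : E (sup E).
  move=> v; have [->|v0] := eqVneq v 0.
    by rewrite /qf mulmx0 /dot !mulmx0 !mxE mulr0.
  by rewrite -ler_pdivlMr ?dot_gt0//; apply: ge_sup (Eub _ v0); exists 0.
suff lam_le : lam <= sup E.
  by move=> v; apply: le_trans (Esup v); rewrite ler_wpM2r ?dot_ge0.
apply: lam_min; pose M := W - (sup E)%:M.
have qfM v : qf M v = qf W v - sup E * dot v v.
  by rewrite qfB [X in _ - X]/qf mul_scalar_mx dotZr.
(* If [M] is singular, a kernel vector makes [sup E] an eigenvalue. If it is invertible, [E]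
   contains a number beyond its supremum. *)
have [Mu|] := boolP (M \in unitmx); last first.
  rewrite -row_free_unit -kermx_eq0 => /rowV0Pn[v /sub_kermxP vM v0].
  apply/eigenvalueP; exists v => //.
  by apply/eqP; rewrite -subr_eq0 -mul_mx_scalar -mulmxBr -/M vM.
exfalso.
have Msym : M^T = M by rewrite linearB/= Wsym tr_scalar_mx.
have [k k0 Nk] := qf_le_dot (invmx M).
suff /(sup_ubound supE.2) : E (sup E + k^-1).
  by rewrite gerDl leNgt invr_gt0 k0.
move=> v; rewrite mulrDl -lerBrDl -qfM.
(* A nonnegative invertible form is bounded below by [k^-1 |v|^2]: evaluate it
   at [v - k^-1 M^-1 v], where [k] bounds the form of [M^-1]. *)
have : 0 <= qf M (v - k^-1 *: (invmx M *m v)).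
  by rewrite qfM subr_ge0 Esup.
rewrite /qf mulmxBr -scalemxAr mulKVmx//.
rewrite dotBr !dotBl !dotZr !dotZl.
rewrite [dot (invmx M *m v) (M *m v)]dot_mulmxl trmx_inv Msym mulKmx//.
rewrite [dot (invmx M *m v) v]dotC -!/(qf _ _).
have kE : k^-1 * (k^-1 * (k * dot v v)) = k^-1 * dot v v by rewrite mulKf ?gt_eqF.
have : k^-1 * (k^-1 * qf (invmx M) v) <= k^-1 * (k^-1 * (k * dot v v)).
  by rewrite !ler_wpM2l ?invr_ge0 ?(ltW k0).
rewrite kE.
lra.
Qed.

(** * The Riccati equation *)

Section Riccati.
Context {R : realType} {n : nat}.

(** Inversion reverses the order of forms. With [y = invmx S *m w], both [qf S y] and
    [qf (invmx S) w] equal [dot y w], and completing the square in the diagonal form gives the upper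
    bound. *)
Lemma qf_invmx_bounds (d : 'rV[R]_n) (S : 'M[R]_n) :
  (forall j, 0 < d 0 j) -> (forall v, qf (diag_mx d) v <= qf S v) ->
  S \in unitmx /\
  forall w, 0 <= qf (invmx S) w <= \sum_j w j 0 ^+ 2 / d 0 j.
Proof.
move=> d0 dS.
have dge0 (v : 'cV_n) : 0 <= qf (diag_mx d) v.
  by rewrite qf_diag sumr_ge0// => j _; rewrite mulr_ge0 ?sqr_ge0// ltW.
have Su : S \in unitmx.
  apply: qf_unitmx => v v0; apply: lt_le_trans (dS v).
  rewrite lt0r dge0 andbT; apply: contra v0.
  rewrite qf_diag psumr_eq0 => [/allP h|j _]; last first.
    by rewrite mulr_ge0 ?sqr_ge0// ltW.
  apply/eqP/colP => j; rewrite mxE; apply/eqP.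
  have := h j; rewrite mem_index_enum => /(_ isT).
  by rewrite mulf_eq0 gt_eqF//= sqrf_eq0.
split=> // w; set y := invmx S *m w.
have SE : qf S y = qf (invmx S) w by rewrite /qf mulKVmx// dotC.
rewrite -SE; apply/andP; split; first by apply: le_trans (dS y); exact: dge0.
have yw : qf S y = \sum_j y j 0 * w j 0 by rewrite /qf mulKVmx// dotE.
have h := dS y; rewrite qf_diag in h.
have : 0 <= \sum_j d 0 j * (y j 0 - w j 0 / d 0 j) ^+ 2.
  by apply: sumr_ge0 => j _; rewrite mulr_ge0 ?sqr_ge0// ltW.
under eq_bigr => j _.
  rewrite (_ : _ * _ = d 0 j * y j 0 ^+ 2 - 2 * (y j 0 * w j 0)
                       + w j 0 ^+ 2 / d 0 j); last first.
    by field; rewrite gt_eqF.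
  over.
by rewrite big_split sumrB/= -mulr_sumr -yw; lra.
Qed.

(** The upper bound uses only that the form of the inverse of [C Sigma C^T + V] is nonnegative; the
    lower one uses that [C Sigma C^T + V] dominates the diagonal matrix with entries
    [lam * c j ^+ 2 + s j]. The value of [lam] is left free so that [lam = 0] is available before
    any better bound on [Sigma] is known. *)
Lemma posterior_bounds (c s : 'I_n -> R) (Sigma : 'M[R]_n) (lam : R) :
  let C : 'M[R]_n := diag_mx (\row_j c j) in
  let V : 'M[R]_n := diag_mx (\row_j s j) in
  let P := Sigma - Sigma *m C^T *m invmx (C *m Sigma *m C^T + V) *m C *m Sigma in
  (forall j, 0 < c j) -> (forall j, 0 < s j) ->
  0 <= lam -> (forall v, lam * dot v v <= qf Sigma v) ->
  forall v : 'cV_n,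
    \sum_j lam / (1 + lam * (c j ^+ 2 / s j)) * v j 0 ^+ 2 <= qf P v
      <= \sum_j (c j ^+ 2 / s j)^-1 * v j 0 ^+ 2.
Proof.
move=> C V P c0 s0 lam0 Sig v.
have CT : C^T = C by rewrite tr_diag_mx.
set S := C *m Sigma *m C^T + V in P *.
pose d : 'rV[R]_n := \row_j (lam * c j ^+ 2 + s j).
have d0 j : 0 < d 0 j by rewrite mxE ltr_wpDl// mulr_ge0// sqr_ge0.
have dS w : qf (diag_mx d) w <= qf S w.
  rewrite qfD qf_congr CT.
  apply: (@le_trans _ _ (lam * dot (C *m w) (C *m w) + qf V w)); last first.
    by rewrite lerD2r Sig.
  rewrite dot_sq !qf_diag mulr_sumr -big_split/=; apply: ler_sum => j _.
  by rewrite mul_diag_mx !mxE le_eqVlt; apply/orP; left; apply/eqP; ring.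
have [Su Sinv] := qf_invmx_bounds _ _ d0 dS.
(* Writing [v = C z] turns the form of [P] at [v] into the form of [C P C^T] at [z]. *)
pose z : 'cV[R]_n := \col_j (v j 0 / c j).
have vE : v = C *m z.
  apply/colP => j; rewrite mul_diag_mx !mxE mulrC divfK// gt_eqF//.
have CPC : C *m P *m C^T = V - V *m invmx S *m V.
  have X : C *m Sigma *m C = S - V by rewrite /S CT addrK.
  rewrite /P CT mulmxBr mulmxBl X.
  rewrite (_ : C *m _ *m C = (S - V) *m invmx S *m (S - V)); last first.
    by rewrite -X !mulmxA.
  rewrite !(mulmxBl, mulmxBr) mulmxV// !mul1mx mulmxKV//.
  by rewrite subKr.
have -> : qf P v = qf V z - qf (invmx S) (V *m z).
  have VT : V^T = V by rewrite tr_diag_mx.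
  rewrite vE -{1}CT -qf_congr CPC qfB; congr (_ - _).
  by rewrite -{2}VT qf_congr VT.
have /andP[i0 i1] := Sinv (V *m z).
have zE j : z j 0 = v j 0 / c j by rewrite mxE.
have VzE j : (V *m z) j 0 = s j * (v j 0 / c j) by rewrite mul_diag_mx !mxE.
have qVE : qf V z = \sum_j (c j ^+ 2 / s j)^-1 * v j 0 ^+ 2.
  rewrite qf_diag; apply: eq_bigr => j _; rewrite zE !mxE.
  by field; rewrite !gt_eqF.
apply/andP; split; last by rewrite qVE; lra.
apply: (@le_trans _ _ (qf V z - \sum_j (V *m z) j 0 ^+ 2 / d 0 j)); last by lra.
rewrite qVE -sumrB; apply: ler_sum => j _.
(* Coordinatewise this is an equality: [s/c^2 - (s/c)^2 / (lam c^2 + s) = lam / (1 + lam c^2 /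
   s)]. *)
rewrite le_eqVlt VzE !mxE; apply/orP; left; apply/eqP.
have := d0 j; rewrite !mxE => d0j.
field; rewrite !gt_eqF//=; nra.
Qed.

(** This is what transfers inequalities between quadratic forms to traces. *)
Lemma mxtrace_congr (A P : 'M[R]_n) :
  \tr (A *m P *m A^T) = \sum_i qf P (row i A)^T.
Proof.
apply: eq_bigr => i _; rewrite -qfE trmxK -row_mul !mxE.
by apply: eq_bigr => j _; rewrite !mxE.
Qed.

Lemma mxtrace_congr_le (A P Q : 'M[R]_n) : (forall v, qf P v <= qf Q v) ->
  \tr (A *m P *m A^T) <= \tr (A *m Q *m A^T).
Proof. by move=> PQ; rewrite !mxtrace_congr; apply: ler_sum => i _. Qed.

Lemma mxtrace_scalar_congr (A : 'M[R]_n) k :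
  \tr (A *m k%:M *m A^T) = k * \tr (A^T *m A).
Proof. by rewrite mul_mx_scalar -scalemxAl mxtraceZ mxtrace_mulC. Qed.

Lemma qf_scalar k v : qf (k%:M : 'M[R]_n) v = k * dot v v.
Proof. by rewrite /qf mul_scalar_mx dotZr. Qed.

End Riccati.

(** * The noise level *)

(** With [s = sqrt (2 eps)], subadditivity of the square root bounds the numerator by
    [2 K + s <= s + 9]. The number 36 is [4 * 9], from the discriminant of [eta s^2 - s - 9]. *)
Lemma noise_le {R : rcfType} (K eps eta : R) :
  0 <= K <= 9 / 2 -> 0 < eps -> 0 < eta ->
  1 / 8 * ((1 + Num.sqrt (36 * eta + 1)) / eta) ^+ 2 <= eps ->
  (K + Num.sqrt (K ^+ 2 + 2 * eps)) / (2 * eps) <= eta.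
Proof.
move=> /andP[K0 K1] e0 eta0 h.
set q := Num.sqrt (36 * eta + 1) in h.
have q0 : 0 <= q by exact: sqrtr_ge0.
have q2 : q ^+ 2 = 36 * eta + 1 by rewrite sqr_sqrtr//; lra.
pose s := Num.sqrt (2 * eps).
have s0 : 0 <= s by exact: sqrtr_ge0.
have s2 : s ^+ 2 = 2 * eps by rewrite sqr_sqrtr//; lra.
(* The factor [1 / 8] matches [(2 s)^2 = 8 eps]. *)
have hs : (1 + q) / eta <= 2 * s.
  rewrite -ler_sqr ?nnegrE ?divr_ge0 ?mulr_ge0 ?addr_ge0 ?(ltW eta0)//.
  by rewrite [leRHS]exprMn s2; lra.
rewrite ler_pdivrMr// in hs.
have hs2 : s + 9 <= eta * s ^+ 2.
  have : q ^+ 2 <= (2 * s * eta - 1) ^+ 2 by rewrite ler_sqr ?nnegrE; lra.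
  by rewrite q2 => ?; nra.
rewrite ler_pdivrMr; last by lra.
have : Num.sqrt (K ^+ 2 + 2 * eps) <= K + s.
  have Ks : 0 <= K + s by lra.
  by rewrite -[leRHS]ger0_norm// -sqrtr_sqr ler_sqrt ?sqr_ge0//; nra.
by rewrite -s2; lra.
Qed.

(** Both terms of the numerator are at least 1, while [eta * (2 * eps) <= 2]. *)
Lemma noise_ge {R : rcfType} (K eps eta : R) :
  1 <= K -> 0 < eps -> 0 < eta -> eps <= 1 / eta ->
  eta <= (K + Num.sqrt (K ^+ 2 + 2 * eps)) / (2 * eps).
Proof.
move=> K1 e0 eta0; rewrite ler_pdivlMr// => h.
have : 1 <= Num.sqrt (K ^+ 2 + 2 * eps).
  by rewrite -[leLHS]sqrtr1 ler_sqrt; nra.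
by rewrite ler_pdivlMr ?mulr_gt0//; lra.
Qed.

(** * Trace bounds for the a priori error covariance *)

Theorem theorem7 (R : realType) (n N : nat)
  (* owner j = the agent owning state coordinate j *)
  (owner : 'I_n -> 'I_N) (howner : forall i : 'I_N, exists j, owner j = i)
  (A W : 'M[R]_n) (c : 'I_n -> R)
  (b Delta delta K eps : 'I_N -> R)
  (lamW Bl Bu : R) (l u : 'I_n) (Sigma : 'M[R]_n) :
  let C : 'M[R]_n := diag_mx (\row_j c j) in
  let sigma (i : 'I_N) : R :=
    Delta i / (2 * eps i) * (K i + Num.sqrt (K i ^+ 2 + 2 * eps i)) in
  let V : 'M[R]_n := diag_mx (\row_j (sigma (owner j)) ^+ 2) in
  let dare (S : 'M[R]_n) : Prop :=
    S = A *m S *m A^T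
        - A *m S *m C^T *m invmx (C *m S *m C^T + V) *m C *m S *m A^T + W in
  let ratio (j : 'I_n) : R := c j ^+ 2 / (sigma (owner j)) ^+ 2 in
  let rad1 (i : 'I_N) : R :=
    (Bl - \tr W) * lamW * c u ^+ 2 /
      (Delta i ^+ 2 * (\tr (A^T *m A) * lamW - Bl + \tr W)) in
  let rad2 (i : 'I_N) : R :=
    (Bu - \tr W) * c l ^+ 2 / (Delta i ^+ 2 * \tr (A^T *m A)) in
  let eta1 (i : 'I_N) : R := Num.sqrt (rad1 i) in
  let eta2 (i : 'I_N) : R := Num.sqrt (rad2 i) in
  pd W ->
  (forall j, 0 < c j) ->
  (forall i, 0 < b i) ->
  (forall i, sens_sq owner C i (b i) = ((Delta i) ^+ 2)%:E) ->
  (forall i, 0 < Delta i) ->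
  (forall i, 10 ^- 5 <= delta i <= 10 ^- 1) ->
  (forall i, Qfun (K i) = delta i) ->
  (forall i, 0 < eps i) ->
  is_min_eigenvalue W lamW ->
  (forall j, ratio l <= ratio j) ->
  (forall j, ratio j <= ratio u) ->
  psd Sigma -> dare Sigma ->
  (forall S, psd S -> dare S -> S = Sigma) ->
  (forall i, 0 < rad1 i) -> (forall i, 0 < rad2 i) ->
  (forall i, 1 / 8 * ((1 + Num.sqrt (36 * eta2 i + 1)) / eta2 i) ^+ 2 <= eps i
             <= 1 / eta1 i) ->
  Bl <= \tr Sigma <= Bu.

Proof.
move=> C sigma V dare ratio rad1 rad2 eta1 eta2 Wpd c0 _ _ Delta0 delta_bd QK eps0
  Wmin rl ru [Ssym Spsd] Sdare _ rad1_gt0 rad2_gt0 eps_bd.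
have K1 i : 1 <= K i.
  apply: Qfun_ge_inv; rewrite QK; have /andP[dl ->] := delta_bd i.
  by rewrite andbT; apply: lt_le_trans dl; rewrite invr_gt0 exprn_gt0.
have K9 i : K i <= 9 / 2.
  by apply: Qfun_le_inv; rewrite QK; have /andP[] := delta_bd i.
have sigmaE i : sigma i =
    Delta i * ((K i + Num.sqrt (K i ^+ 2 + 2 * eps i)) / (2 * eps i)).
  by rewrite /sigma -mulrA [_^-1 * _]mulrC.
have eta1_gt0 i : 0 < eta1 i by rewrite sqrtr_gt0.
have eta2_gt0 i : 0 < eta2 i by rewrite sqrtr_gt0.
have sigma_ge i : Delta i * eta1 i <= sigma i.
  rewrite sigmaE ler_wpM2l ?(ltW (Delta0 i))//.
  by apply: noise_ge => //; have /andP[] := eps_bd i.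
have sigma_le i : sigma i <= Delta i * eta2 i.
  rewrite sigmaE ler_wpM2l ?(ltW (Delta0 i))//.
  apply: noise_le => //; last by have /andP[] := eps_bd i.
  by rewrite K9 andbT (le_trans ler01).
have sigma_gt0 i : 0 < sigma i.
  by apply: lt_le_trans (sigma_ge i); rewrite mulr_gt0.
have sigma2_ge i : Delta i ^+ 2 * rad1 i <= sigma i ^+ 2.
  rewrite -[rad1 i]sqr_sqrtr ?(ltW (rad1_gt0 i))// -exprMn -/(eta1 i).
  by rewrite ler_sqr ?nnegrE ?(ltW (sigma_gt0 i))// ltW// mulr_gt0.
have sigma2_le i : sigma i ^+ 2 <= Delta i ^+ 2 * rad2 i.
  rewrite -[rad2 i]sqr_sqrtr ?(ltW (rad2_gt0 i))// -exprMn -/(eta2 i).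
  by rewrite ler_sqr ?nnegrE ?(ltW (sigma_gt0 i))// ltW// mulr_gt0.
pose s j := sigma (owner j) ^+ 2.
have s0 j : 0 < s j by rewrite exprn_gt0.
have ratio_gt0 j : 0 < ratio j by rewrite divr_gt0// exprn_gt0.
pose P := Sigma - Sigma *m C^T *m invmx (C *m Sigma *m C^T + V) *m C *m Sigma.
have SP : Sigma = A *m P *m A^T + W.
  by rewrite {1}Sdare mulmxBr mulmxBl !mulmxA.
have [lam0 Wlam] := rayleigh _ _ l Wpd Wmin.
(* Bootstrap: [lam = 0] gives that [P] is nonnegative, hence [Sigma] dominates [W], and the same
   bounds then apply with [lam = lamW]. *)
have qSig0 v : 0 * dot v v <= qf Sigma v by rewrite mul0r -qfE.
have qP0 v : 0 <= qf P v.
  have /andP[+ _] := posterior_bounds _ _ _ _ c0 s0 (lexx 0) qSig0 v.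
  by apply: le_trans; apply: sumr_ge0 => j _; rewrite mul0r mul0r.
have qSig v : lamW * dot v v <= qf Sigma v.
  rewrite SP qfD qf_congr; apply: (le_trans (Wlam v)).
  by rewrite lerDr qP0.
have qP v := posterior_bounds _ _ _ _ c0 s0 (ltW lam0) qSig v.
(* The map sending [r] to [lamW / (1 + lamW r)] decreases, so the worst coordinate is the one with
   the largest ratio. *)
have P_ge v : qf ((lamW / (1 + lamW * ratio u))%:M : 'M[R]_n) v <= qf P v.
  have /andP[+ _] := qP v; apply: le_trans.
  rewrite qf_scalar dot_sq mulr_sumr; apply: ler_sum => j _.
  rewrite ler_wpM2r ?sqr_ge0// ler_wpM2l ?(ltW lam0)//.
  have dj i : 0 < 1 + lamW * ratio i by rewrite ltr_pwDl// mulr_ge0// ltW.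
  by rewrite -[c j ^+ 2 / s j]/(ratio j)
    lef_pV2 ?posrE ?dj// lerD2l ler_wpM2l ?(ltW lam0).
have P_le v : qf P v <= qf (((ratio l)^-1)%:M : 'M[R]_n) v.
  have /andP[_] := qP v; move/le_trans; apply.
  rewrite qf_scalar dot_sq mulr_sumr; apply: ler_sum => j _.
  by rewrite -[c j ^+ 2 / s j]/(ratio j) ler_wpM2r ?sqr_ge0// lef_pV2 ?posrE ?ratio_gt0.
have := mxtrace_congr_le A _ _ P_ge; have := mxtrace_congr_le A _ _ P_le.
rewrite !mxtrace_scalar_congr => tr_le tr_ge.
have trS : \tr Sigma = \tr (A *m P *m A^T) + \tr W by rewrite {1}SP mxtraceD.
have trP0 : 0 <= \tr (A *m P *m A^T).
  by rewrite mxtrace_congr sumr_ge0.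
have T_ge0 : 0 <= \tr (A^T *m A).
  rewrite -[leRHS]mul1r -mxtrace_scalar_congr mxtrace_congr sumr_ge0// => i _.
  by rewrite qf_scalar mul1r dot_ge0.
have T_gt0 : 0 < \tr (A^T *m A).
  (* A zero trace would make [rad2] zero, division by zero being zero, against its positivity. *)
  rewrite lt0r T_ge0 andbT; apply/eqP => T0.
  by have := rad2_gt0 (owner l); rewrite /rad2 T0 mulr0 invr0 mulr0 ltxx.
have Dsq i : 0 < Delta i ^+ 2 by rewrite exprn_gt0.
have csq j : 0 < c j ^+ 2 by rewrite exprn_gt0.
rewrite trS; apply/andP; split; last first.
  rewrite -lerBrDr; apply: (le_trans tr_le); rewrite invf_div.
  rewrite mulrAC ler_pdivrMr// -ler_pdivlMr//.
  (* The sensitivity cancels: [Delta^2 * rad2] is [(Bu - tr W) c_l^2 / tr (A^T A)]. *)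
  apply: (le_trans (sigma2_le (owner l))); rewrite le_eqVlt; apply/orP; left.
  by apply/eqP; rewrite /rad2; field; rewrite !gt_eqF//= Delta0.
(* For [Bl <= tr W] nonnegativity of [P] suffices. Otherwise the numerator of [rad1] is positive, so
   the positivity of [rad1] forces that of its denominator. *)
rewrite -lerBlDr; have [D0|D0] := leP (Bl - \tr W) 0; first exact: le_trans trP0.
apply: le_trans tr_ge.
have := sigma2_ge (owner u); have := rad1_gt0 (owner u); rewrite /rad1.
have -> : \tr (A^T *m A) * lamW - Bl + \tr W
    = \tr (A^T *m A) * lamW - (Bl - \tr W) by ring.
have := ratio_gt0 u.
set D := Bl - _ in D0 *; set T := \tr (A^T *m A) in T_gt0 *.
set E := T * lamW - D => ru0.
rewrite pmulr_rgt0 ?mulr_gt0// invr_gt0 pmulr_rgt0// => E0.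
rewrite invfM [X in X <= _]mulrCA mulVKf ?gt_eqF// ler_pdivrMr// => h.
rewrite mulrAC ler_pdivlMr; last by rewrite addr_gt0// mulr_gt0.
(* Since [E = T * lamW - D], this is the goal [D * (1 + lamW * ratio u) <= T * lamW] rearranged. *)
have : D * (lamW * ratio u) <= E.
  rewrite mulrA /ratio mulrA ler_pdivrMr; last exact: s0.
  by rewrite [leRHS]mulrC.
by rewrite /E; lra.
Qed.
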